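(* Every cubic graph on $n$ vertices (not necessarily connected) has an induced path factor with at most $n/2$ paths. Moreover, equality holds (that is, the minimum number $\rho(G)$ of paths in an induced path factor of the cubic graph $G$ equals $n/2$) if and only if every connected component of $G$ is isomorphic to the complete graph $K_4$.
   Context: Graphs are finite and simple. A cubic graph is a $3$-regular graph. A subgraph $H$ of $G$ is induced if any two vertices of $H$ are adjacent in $H$ if and only if they are adjacent in $G$. An induced path factor (IPF) of a graph $G$ is a set of induced paths in $G$ such that every vertex of $G$ is in exactly one of the paths; paths of any length are allowed, including trivial paths consisting of a single vertex. The induced path number $\rho(G)$ is the minimum number of paths in an IPF of $G$. *)

(* Defs.v *)
From mathcomp Require Import all_boot.

Set Implicit Arguments.
Unset Strict Implicit.
Unset Printing Implicit Defensive.

(* A finite simple graph is a symmetric irreflexive relation e on a finType T. *)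

Section Graphs.
Variables (T : finType) (e : rel T).

Definition cubic := forall x : T, #|[set y | e x y]| = 3.

Definition components : {set {set T}} :=
  equivalence_partition (connect e) [set: T].

(* The subgraph induced by e on A is isomorphic to the graph (U, r). *)
Definition induced_iso (A : {set T}) (U : finType) (r : rel U) :=
  exists f : U -> T,
    [/\ injective f, f @: [set: U] = A & forall u v, e (f u) (f v) = r u v].

Definition is_path (s : seq T) := [&& s != [::], uniq s & sorted e s].

(* Adjacency in the path with vertex sequence s. *)
Definition path_adj (s : seq T) : rel T :=
  [rel x y | infix [:: x; y] s || infix [:: y; x] s].

Definition is_induced_path (s : seq T) :=
  is_path s && [forall x in s, forall y in s, path_adj s x y == e x y].

(* An induced path is the subgraph induced by its vertex set, so it is encoded
   by that set; this also identifies a vertex sequence with its reversal. *)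
Definition induced_path_on (A : {set T}) :=
  [exists s : #|A|.-tuple T, is_induced_path s && ([set x in s] == A)].

Definition is_ipf (P : {set {set T}}) :=
  partition P [set: T] && [forall A in P, induced_path_on A].

Definition trivial_ipf : {set {set T}} := [set [set x] | x : T].

(* The minimum is attained at an actual IPF because trivial_ipf is one; see
   induced_path_numberP. *)
Definition induced_path_number : nat :=
  #|[arg min_(P < trivial_ipf | is_ipf P) #|P|]|.

Lemma trivial_ipfP : irreflexive e -> is_ipf trivial_ipf.
Proof.
move=> irr; apply/andP; split.
  apply/and3P; split.
  - rewrite eqEsubset subsetT; apply/subsetP => x _.
    by apply/bigcupP; exists [set x]; rewrite ?imset_f ?set11.
  - apply/trivIsetP => _ _ /imsetP[x _ ->] /imsetP[y _ ->].
    by rewrite disjoints1 in_set1; apply: contraNN => /eqP->.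
  - by apply/negP => /imsetP[x _ /setP /(_ x)]; rewrite !inE eqxx.
apply/'forall_implyP => _ /imsetP[x _ ->].
have sz : size [:: x] == #|[set x]| by rewrite cards1.
apply/existsP; exists (Tuple sz); apply/andP; split.
  apply/andP; split=> //.
  apply/'forall_implyP => y; rewrite inE => /eqP->.
  apply/'forall_implyP => z; rewrite inE => /eqP->.
  by rewrite irr /path_adj /= !andbF.
by apply/eqP/setP => y; rewrite !inE.
Qed.

Lemma induced_path_numberP : irreflexive e ->
  (exists2 P, is_ipf P & #|P| = induced_path_number) /\
  (forall P, is_ipf P -> induced_path_number <= #|P|).
Proof.
move=> /trivial_ipfP ipf0; rewrite /induced_path_number.
by case: arg_minnP => // P ipfP minP; split=> //; exists P.
Qed.

End Graphs.

Definition complete_graph (n : nat) : rel 'I_n := [rel i j | i != j].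
Arguments complete_graph : clear implicits.

(* Main.v *)
Require Import Defs.
From mathcomp Require Import all_boot zify.

Set Implicit Arguments.
Unset Strict Implicit.
Unset Printing Implicit Defensive.

(** A cubic graph has a permutation f with x adjacent to f x (a perfect matching
    of the bipartite double cover); cutting its cycles splits the vertices into
    blocks inducing an edge, a path on three vertices, or a triangle.  With as
    few triangles as possible, the third neighbour of every triangle vertex is
    the midpoint of a three-vertex path, so three times the number of triangles
    is at most the number of such paths.  Splitting each triangle into an edge
    and a vertex gives at most n/2 paths, and fewer than n/2 unless all blocks
    are edges.

    In that last case the blocks form a perfect matching.  If no two matching
    edges can be merged into one induced path and no three into two, then each
    pair of adjacent matching edges is joined by at least two edges, and a case
    analysis leaves only K4 components.  Conversely an induced path in a union
    of K4's has at most two vertices. *)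

(** * A permutation along the edges of a regular graph, by augmenting paths *)

Section RegularPermutation.
Variables (T : finType) (e : rel T).
Hypothesis e_sym : symmetric e.

(** Alternating path in the bipartite double cover: redirecting [u] from [r] to [w] puts [w] into
    the image. If [r] keeps another preimage, the image has grown; otherwise [r] becomes the missing
    value and the rest of the path is used. The doubly hit last value guarantees an eventual
    gain. *)
Lemma augment (p : seq T) (w : T) (f : {ffun T -> T}) :
    (forall x, e x (f x)) -> w \notin codom f ->
    path (fun r s => [exists u, e u r && (f u == s)]) w p -> uniq (w :: p) ->
    (exists u1 u2, [/\ u1 != u2, f u1 = last w p & f u2 = last w p]) ->
  exists2 g : {ffun T -> T}, forall x, e x (g x) & #|codom f| < #|codom g|.
Proof.
elim: p w f => [|r p IHp] w f ef wNf.
  by move=> _ _ [u [_ [_ /= fu _]]]; rewrite -fu codom_f in wNf.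
move=> /andP[/existsP[u /andP[euw /eqP fu]] path_p] /andP[wNrp uniq_rp] dbl.
have wr : w != r by apply: contraNneq wNrp => ->; rewrite mem_head.
pose g := [ffun x => if x == u then w else f x].
have eg x : e x (g x) by rewrite ffunE; case: eqP => // ->.
have gNu x : x != u -> g x = f x by rewrite ffunE => /negPf->.
have gu : g u = w by rewrite ffunE eqxx.
have [/existsP[v /andP[vu /eqP fv]]|/existsPn onlyu] :=
  boolP [exists v, (v != u) && (f v == r)].
  exists g => //; apply: proper_card; apply/properP; split; last first.
    by exists w => //; rewrite -gu codom_f.
  apply/subsetP => _ /codomP[x ->]; have [->|xu] := eqVneq x u.
    by rewrite fu -fv -gNu // codom_f.
  by rewrite -gNu // codom_f.
have fr x : f x = r -> x = u.
  by move=> fx; apply/eqP; have := onlyu x; rewrite fx eqxx andbT negbK.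
have rNg : r \notin codom g.
  apply/codomP => -[x]; have [->|xu] := eqVneq x u.
    by rewrite gu => /esym/eqP; rewrite (negPf wr).
  by rewrite gNu // => /esym/fr/eqP; rewrite (negPf xu).
have card_g : #|codom f| = #|codom g|.
  have -> : #|codom f| = #|[set x in codom f]| by rewrite cardsE.
  have -> : #|codom g| = #|[set x in codom g]| by rewrite cardsE.
  have -> : [set x in codom g] = w |: ([set x in codom f] :\ r).
    apply/setP => y; rewrite !inE; apply/codomP/orP => [[x ->]|].
      have [->|xu] := eqVneq x u; first by left; rewrite gu.
      right; rewrite gNu // codom_f andbT.
      by apply: contraNneq xu => /fr->.
    move=> [/eqP->|/andP[yr /codomP[x yE]]]; first by exists u; rewrite gu.
    by exists x; rewrite gNu // -?yE //; apply: contraNneq yr => xu; rewrite yE xu fu.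
  rewrite cardsU1 !inE (negPf wNf) andbF add1n.
  by rewrite [LHS](cardsD1 r) inE -fu codom_f.
rewrite card_g; move: dbl uniq_rp => [u1 [u2 [u12 fu1 fu2]]] /= /andP[rNp uniq_p].
(* Here [u] is the only preimage of [r], so [r] cannot be the doubly hit end of the path. *)
have lastr : last r p != r.
  apply: contra_neq u12 => lr.
  by have [-> ->] : u1 = u /\ u2 = u by split; apply: fr; rewrite ?fu1 ?fu2.
apply: (IHp r g) => //=; last 2 first.
- by rewrite rNp.
- exists u1, u2; rewrite !gNu //.
    by apply: contraNneq lastr => uu; rewrite -[last _ _]fu2 uu fu.
  by apply: contraNneq lastr => uu; rewrite -[last _ _]fu1 uu fu.
have next_g s t : t != r -> [exists u, e u s && (f u == t)] ->
    [exists u, e u s && (g u == t)].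
  move=> tr /existsP[v /andP[evs /eqP fv]].
  apply/existsP; exists v; rewrite evs gNu ?fv //=.
  by apply: contraNneq tr => vu; rewrite -fv vu fu.
have allr : all (fun t => t != r) p.
  by apply/allP => t tp; apply: contraNneq rNp => <-.
have next_g_path s q : path (fun r s => [exists u, e u r && (f u == s)]) s q ->
    all (fun t => t != r) q -> path (fun r s => [exists u, e u r && (g u == s)]) s q.
  elim: q s => //= t q IHq s /andP[st path_q] /andP[tr allq].
  by rewrite next_g ?IHq.
exact: next_g_path path_p allr.
Qed.

(** A map along edges with the largest image is onto: a missing value [w] would yield a set [R] of
    values with fewer than [#|R|] neighbours, which regularity forbids. *)
Lemma regular_permutation (k : nat) :
    0 < k -> (forall x, #|[set y | e x y]| = k) ->
  exists2 f : T -> T, injective f & forall x, e x (f x).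
Proof.
move=> k_gt0 reg.
have [f0 ef0] : exists f : {ffun T -> T}, forall x, e x (f x).
  exists [ffun x => odflt x [pick y | e x y]] => x; rewrite ffunE.
  case: pickP => [//|none]; have := k_gt0; rewrite -(reg x).
  by rewrite eq_card0 // => y; rewrite inE none.
pose P (f : {ffun T -> T}) := [forall x, e x (f x)].
have P0 : P f0 by apply/forallP.
case: (arg_maxnP (fun f : {ffun T -> T} => #|codom f|) P0) => f /forallP ef fmax.
exists f => //.
suff /image_injP inj : #|codom f| == #|T| by move=> x y; apply: inj.
rewrite eqn_leq leq_image_card /=.
apply: subset_leq_card; apply/subsetP => w _; apply/negPn/negP => wNf.
pose next r s := [exists u, e u r && (f u == s)].
pose R := [set r | connect next w r].
have wR : w \in R by rewrite inE connect0.
(* A value in [R] with two preimages ends an augmenting path, against the maximality of [f]. *)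
have onepre u1 u2 : f u1 \in R -> f u1 = f u2 -> u1 = u2.
  rewrite inE => /connectP[p0 path_p0 lastp0] f12; apply/eqP/negPn/negP => u12.
  case/shortenP: path_p0 lastp0 => p path_p uniq_p _ lastp.
  have [|g eg] := augment ef wNf path_p uniq_p.
    by exists u1, u2; rewrite -f12 lastp.
  have /fmax : P g by apply/forallP.
  by rewrite /geq /= leqNgt => /negP ge_fg lt_fg; apply: ge_fg.
pose N := [set u | f u \in R].
have closed r u : r \in R -> e r u -> u \in N.
  rewrite !inE => wr eru; apply: connect_trans wr _; apply: connect1.
  by apply/existsP; exists u; rewrite e_sym eru eqxx.
(* [f] maps [N] injectively into [R] without [w]. *)
have ltNR : #|N| < #|R|.
  rewrite (cardsD1 w R) wR add1n ltnS -(card_in_imset (f := f) (D := mem N)).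
    apply: subset_leq_card; apply/subsetP => _ /imsetP[u uN ->].
    rewrite 2!inE; move: uN; rewrite inE => ->; rewrite andbT.
    by apply: contraNneq wNf => <-; rewrite codom_f.
  by move=> u1 u2; rewrite inE => u1N _; apply: onepre.
(* Count adjacent pairs [u] in [N], [r] in [R]: each [r] has all its [k] neighbours in [N], each [u]
   has at most [k] in [R]. *)
have : k * #|R| <= k * #|N|.
  have deg x : \sum_y (e x y : nat) = k.
    by rewrite -(reg x) -sum1_card [RHS]big_mkcond; apply: eq_bigr => y _;
       rewrite inE; case: (e x y).
  rewrite ![k * _]mulnC -!sum_nat_const.
  have -> : \sum_(r in R) k = \sum_(u in N) \sum_(r in R) (e u r : nat).
    rewrite exchange_big; apply: eq_bigr => r rR /=.
    rewrite -(deg r) (bigID (mem N)) /= [X in _ + X]big1 ?addn0.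
      by apply: eq_bigr => u _; rewrite e_sym.
    by move=> u uN; apply/eqP; rewrite eqb0; apply: contraNN uN; apply: closed.
  apply: leq_sum => u _; rewrite -[leqRHS](deg u) [leqRHS](bigID (mem R)) /=.
  exact: leq_addr.
by rewrite leq_pmul2l // leqNgt ltNR.
Qed.

End RegularPermutation.

(** * Blocks of a duplicate-free concatenation *)

Lemma flatten_uniq_disj (T : eqType) (L : seq (seq T)) (s t : seq T) (x : T) :
  uniq (flatten L) -> s \in L -> t \in L -> x \in s -> x \in t -> s = t.
Proof.
elim: L => // u L IHL /=; rewrite cat_uniq => /and3P[_ uL uniq_L].
have uF v : v \in L -> x \in u -> x \in v -> False.
  move=> vL xu xv; move/hasPn: uL => /(_ x); rewrite /= xu => /(_ _)/negP; apply=> //.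
  by apply/flattenP; exists v.
rewrite !inE => /predU1P[->|sL] /predU1P[->|tL] xs xt //; last exact: IHL.
  by case: (uF t).
by case: (uF s).
Qed.

Lemma flatten_uniq_mem (T : eqType) (L : seq (seq T)) (s : seq T) :
  uniq (flatten L) -> s \in L -> uniq s.
Proof.
elim: L => // u L IHL /=; rewrite cat_uniq inE.
by move=> /and3P[uniq_u _ uniq_L] /predU1P[->|] //; apply: IHL.
Qed.

(** * Induced path factors as lists of vertex sequences *)

Section PathCovers.
Variables (T : finType) (e : rel T).
Hypotheses (e_sym : symmetric e) (e_irr : irreflexive e).

(** A recursive form of inducedness that computes on explicit sequences: each vertex is adjacent to
    its successor and to no later vertex. *)
Fixpoint chordless (s : seq T) : bool :=
  if s is x :: s' then
    (if s' is y :: s'' then e x y && all (fun z => ~~ e x z) s'' else true)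
    && chordless s'
  else true.

Definition path_cover (L : seq (seq T)) :=
  perm_eq (flatten L) (enum T) && all (fun s => (s != [::]) && chordless s) L.

Lemma chordless_sorted (s : seq T) : chordless s -> sorted e s.
Proof.
elim: s => [|x [|y s] IHs] //= /andP[/andP[exy _] chs].
by rewrite exy; apply: IHs.
Qed.

Lemma infix2_cons (x y z : T) (s : seq T) : z \notin s -> x \in s -> y \in s ->
  infix [:: x; y] (z :: s) = infix [:: x; y] s.
Proof.
move=> zs xs ys; rewrite [LHS]/=.
by have -> : (x == z) = false by apply: contraNF zs => /eqP<-.
Qed.

Lemma infix2_head (x y : T) (s : seq T) : x \notin s ->
  infix [:: x; y] (x :: s) = (ohead s == Some y).
Proof.
move=> xs /=; rewrite eqxx.
have -> : infix [:: x; y] s = false.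
  by apply: contraNF xs => /mem_infix; apply; rewrite mem_head.
by rewrite orbF; case: s {xs} => //= z s; rewrite prefix0s andbT eq_sym.
Qed.

Lemma infix2_tail (x y : T) (s : seq T) : x \notin s -> y \in s ->
  infix [:: y; x] (x :: s) = false.
Proof.
move=> xs ys /=; have -> : (y == x) = false by apply: contraNF xs => /eqP<-.
by apply: contraNF xs => /mem_infix; apply; rewrite !inE eqxx orbT.
Qed.

Lemma path_adjE (s : seq T) (x y : T) :
  path_adj s x y = infix [:: x; y] s || infix [:: y; x] s.
Proof. by []. Qed.

(** Only pairs with the head [z] are new at each induction step; as [s] has no repetition, [z] is
    followed by the first vertex of the tail alone. *)
Lemma chordless_adj (s : seq T) : uniq s -> chordless s ->
  {in s &, forall x y, path_adj s x y = e x y}.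
Proof.
elim: s => // z s IHs /= /andP[zs uniq_s] /andP[ez chs].
have adj_z y : y \in s -> path_adj (z :: s) z y = e z y.
  move=> ys; rewrite path_adjE (infix2_head _ zs) (infix2_tail zs ys) orbF.
  case: s ez ys uniq_s {IHs zs chs} => // t s /andP[ezt nez].
  rewrite inE => /predU1P[->|ys] /andP[ts _]; first by rewrite ezt eqxx.
  rewrite (negPf (allP nez y ys)); by apply: contraNF ts => /eqP[->].
have adj_sym : symmetric (path_adj (z :: s)).
  by move=> x y; rewrite !path_adjE orbC.
move=> x y; rewrite !inE => /predU1P[->|xs] /predU1P[->|ys].
- rewrite e_irr path_adjE orbb (infix2_head _ zs).
  case: s zs {IHs ez adj_z adj_sym uniq_s chs} => //= t s.
  by apply: contraNF => /eqP[->]; rewrite mem_head.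
- exact: adj_z.
- by rewrite adj_sym e_sym adj_z.
by rewrite -IHs // !path_adjE !infix2_cons.
Qed.

Lemma chordless_induced_path (s : seq T) :
  s != [::] -> uniq s -> chordless s -> is_induced_path e s.
Proof.
move=> s0 uniq_s chs; rewrite /is_induced_path /is_path s0 uniq_s.
rewrite chordless_sorted //=; apply/'forall_implyP => x xs.
by apply/'forall_implyP => y ys; rewrite chordless_adj.
Qed.

Lemma path_cover_ipf (L : seq (seq T)) : path_cover L ->
  exists2 P : {set {set T}}, is_ipf e P & #|P| <= size L.
Proof.
move=> /andP[perm_L chL].
have uniq_L : uniq (flatten L) by rewrite (perm_uniq perm_L) enum_uniq.
have inL x : x \in flatten L by rewrite (perm_mem perm_L) mem_enum.
pose P := [set A in [seq [set x in s] | s : seq T <- L]].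
exists P; last first.
  by rewrite cardsE -(size_map (fun s : seq T => [set x in s])); apply: card_size.
have L_disj := flatten_uniq_disj uniq_L.
apply/andP; split.
  apply/and3P; split.
  - rewrite eqEsubset subsetT; apply/subsetP => x _.
    have /flattenP[s sL xs] := inL x.
    by apply/bigcupP; exists [set x in s]; rewrite inE //; apply: map_f.
  - apply/trivIsetP => A B; rewrite !inE => /mapP[s sL ->] /mapP[t tL ->].
    apply: contraR => /pred0Pn[x /=]; rewrite !inE => /andP[xs xt].
    by rewrite (L_disj s t x).
  - rewrite inE; apply/mapP => -[[|x s] sL]; first by have /andP[] := allP chL _ sL.
    by move=> /setP/(_ x); rewrite !inE eqxx.
apply/'forall_implyP => A; rewrite inE => /mapP[s sL ->].
have /andP[s0 chs] := allP chL s sL.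
have uniq_s := flatten_uniq_mem uniq_L sL.
have sz : size s == #|[set x in s]| by rewrite cardsE (card_uniqP uniq_s).
by apply/existsP; exists (Tuple sz); rewrite chordless_induced_path /=.
Qed.
End PathCovers.

(** Explicit sequences are rearrangements of each other when their counts agree for every predicate,
    which is linear arithmetic. *)
Ltac perm_lia :=
  apply/permP; intro; rewrite /=;
  repeat match goal with H : _ |- _ => clear H end; lia.

(** * Cutting into edges and triples, with few triangles *)

Section Fragmentations.
Variables (T : finType) (e : rel T).

(** The ends of a triple are left unconstrained: it is a triangle if they are adjacent and an
    induced path otherwise. *)
Definition fragment (s : seq T) : bool :=
  match s with
  | [:: x; y] => e x y
  | [:: x; y; z] => e x y && e y z
  | _ => false
  end.

Definition triangle (s : seq T) : bool :=
  if s is [:: x; y; z] then e x z else false.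

Definition fragmentation (s : seq T) (F : seq (seq T)) :=
  perm_eq (flatten F) s && all fragment F.

Lemma fragmentation_cat (s1 s2 : seq T) (F1 F2 : seq (seq T)) :
  fragmentation s1 F1 -> fragmentation s2 F2 -> fragmentation (s1 ++ s2) (F1 ++ F2).
Proof.
move=> /andP[p1 a1] /andP[p2 a2].
by rewrite /fragmentation flatten_cat perm_cat // all_cat a1.
Qed.

(** An edge is cut off the front while at least four vertices remain, so the rest never shrinks to a
    single vertex. *)
Lemma path_fragmentation (s : seq T) :
  sorted e s -> 1 < size s -> exists F, fragmentation s F.
Proof.
have [n] := ubnP (size s); elim: n s => // n IHn [|x [|y [|z [|t s]]]] //.
- by move=> _ /= exy _; exists [:: [:: x; y]]; rewrite /fragmentation /= perm_refl exy.
- move=> _ /= exyz _; exists [:: [:: x; y; z]].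
  by rewrite /fragmentation /= perm_refl -(andbT (e y z)) exyz.
move=> lt_n /= /and3P[exy _ path_s] _.
have [|//|F fragF] := IHn (z :: t :: s) _ path_s; first by move: lt_n => /=; lia.
exists ([:: x; y] :: F); apply: (@fragmentation_cat [:: x; y] _ [:: [:: x; y]]) fragF.
by rewrite /fragmentation /= perm_refl exy.
Qed.

(** Each cycle of [f] is traversed along edges and can be cut as a path; removing an orbit leaves a
    set closed under [f]. *)
Lemma permutation_fragmentation (f : T -> T) :
    irreflexive e -> injective f -> (forall x, e x (f x)) ->
  exists F, fragmentation (enum T) F.
Proof.
move=> irr f_inj ef.
suff closedF n (A : {set T}) : #|A| < n -> {homo f : x / x \in A} ->
    exists F, fragmentation (enum A) F.
  have [//|//|F] := closedF #|T|.+1 [set: T]; first by rewrite cardsT.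
  by rewrite enum_setT -enumT; exists F.
elim: n A => // n IHn A; rewrite ltnS => leAn clA.
have [->|[x xA]] := set_0Vmem A; first by exists [::]; rewrite enum_set0.
have xO : x \in orbit f x by rewrite -fconnect_orbit connect0.
have sub_orb : {subset orbit f x <= A}.
  move=> y; rewrite -fconnect_orbit => /iter_findex <-.
  by elim: (findex _ _ _) => //= k; apply: clA.
have [||F1 fragF1] := IHn (A :\: [set y in orbit f x]).
- apply: leq_trans leAn; apply: proper_card; apply/properP; split.
    exact: subsetDl.
  by exists x; rewrite // !inE xO.
- move=> y; rewrite !inE -!fconnect_orbit => /andP[xNy yA]; rewrite clA // andbT.
  apply: contraNN xNy => /connect_trans; apply.
  by rewrite fconnect_sym // fconnect1.
have [||F2 fragF2] := @path_fragmentation (orbit f x).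
- have := cycle_orbit f_inj x; case E: (orbit f x) => [//|y s] /=.
  rewrite rcons_path => /andP[path_s _]; apply: sub_path path_s.
  by move=> u v /eqP<-.
(* An orbit of size one would make [x] adjacent to itself. *)
- have := iter_order f_inj x; have := order_gt0 f x; rewrite size_orbit.
  by case: order => [|[|k]] //= _ fx; have := ef x; rewrite fx irr.
exists (F1 ++ F2).
have /andP[permF allF] := fragmentation_cat fragF1 fragF2.
rewrite /fragmentation allF andbT; apply: perm_trans permF _.
apply: uniq_perm.
- rewrite cat_uniq enum_uniq orbit_uniq andbT /=; apply/hasPn => y yO.
  by rewrite mem_enum !inE yO.
- exact: enum_uniq.
move=> y; rewrite mem_cat !mem_enum !inE; case yO: (y \in orbit f x) => /=.
  by rewrite sub_orb.
by rewrite orbF.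
Qed.

Hypotheses (e_sym : symmetric e) (e_irr : irreflexive e) (e_cubic : cubic e).

Lemma cubic_nbr (x : T) (s : seq T) : size s < 3 -> exists2 y, e x y & y \notin s.
Proof.
move=> lt3; have [/existsP[y /andP[exy yNs]]|/existsPn none] :=
  boolP [exists y, e x y && (y \notin s)]; first by exists y.
have : #|[set y | e x y]| <= size s.
  apply: leq_trans (subset_leq_card _) (card_size s).
  by apply/subsetP => y; rewrite inE => exy; have := none y; rewrite exy negbK.
by rewrite e_cubic leqNgt lt3.
Qed.

Lemma cubic_nbrs (x : T) (s : seq T) (y : T) :
  uniq s -> size s = 3 -> all (e x) s -> e x y = (y \in s).
Proof.
move=> uniq_s s3 /allP es.
have /setP/(_ y) : [set z in s] = [set z | e x z].
  apply/eqP; rewrite eqEcard e_cubic cardsE (card_uniqP uniq_s) s3 andbT.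
  by apply/subsetP => z; rewrite !inE; apply: es.
by rewrite !inE.
Qed.

Lemma fragmentation_replace (F S S' R : seq (seq T)) (s : seq T) :
    fragmentation s F -> perm_eq F (S ++ R) ->
    perm_eq (flatten S) (flatten S') -> all fragment S' ->
  fragmentation s (S' ++ R).
Proof.
move=> /andP[permF fragF] permSR permS fragS'; apply/andP; split.
  rewrite -(permPr permF) (permPr (perm_flatten permSR)) !flatten_cat.
  by rewrite perm_cat2r perm_sym.
rewrite all_cat fragS'; move: fragF; rewrite (perm_all _ permSR) all_cat.
by case/andP.
Qed.

Lemma triangle_perm (s : seq T) (x : T) :
    fragment s -> triangle s -> x \in s ->
  exists y z, [/\ perm_eq s [:: x; y; z], e x y, e x z & e y z].
Proof.
case: s => [|a [|b [|c [|d s]]]] //= /andP[eab ebc] eac.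
rewrite !inE => /or3P[]/eqP->.
- by exists b, c.
- exists a, c; split=> //; last by rewrite e_sym.
  by perm_lia.
exists a, b; split=> //; rewrite 1?e_sym //.
by perm_lia.
Qed.

(** The third neighbour [x'] of [x] lies in another block [D]. Unless [D] is an induced triple with
    midpoint [x'], the triangle and [D] can be cut anew without triangles: [y z] becomes an edge and
    [x] joins [x']. *)
Lemma triangle_nbr_or_fewer (F : seq (seq T)) :
    fragmentation (enum T) F ->
  forall s x, s \in F -> triangle s -> x \in s ->
  (exists a b c, [/\ [:: a; b; c] \in F, ~~ e a c & e x b]) \/
  exists2 F', fragmentation (enum T) F' & count triangle F' < count triangle F.
Proof.
move=> fragF s x sF tri_s xs.
have /andP[permF /allP allF] := fragF.
have uniq_F : uniq (flatten F) by rewrite (perm_uniq permF) enum_uniq.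
have [y [z [perm_s exy exz eyz]]] := triangle_perm (allF s sF) tri_s xs.
have [x' exx' x'N] : exists2 x', e x x' & x' \notin [:: y; z] by apply: cubic_nbr.
have /flattenP[D DF x'D] : x' \in flatten F by rewrite (perm_mem permF) mem_enum.
have Ds : D != s.
  apply: contraTneq x'D => ->; rewrite (perm_mem perm_s) inE negb_or x'N andbT.
  by apply: contraTneq exx' => ->; rewrite e_irr.
have permFsD : perm_eq F ([:: s; D] ++ rem D (rem s F)).
  apply: perm_trans (perm_to_rem sF) _; rewrite perm_cons.
  by apply: perm_to_rem; apply: rem_mem.
have uniq_sD : uniq ([:: x; y; z] ++ D).
  move: uniq_F; rewrite (perm_uniq (perm_flatten permFsD)) /= catA cat_uniq.
  case/andP; rewrite (perm_uniq (_ : perm_eq (s ++ D) ([:: x; y; z] ++ D))) //.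
  by rewrite perm_cat2r.
have swap (S : seq (seq T)) : perm_eq ([:: x; y; z] ++ D) (flatten S) ->
    all fragment S -> count triangle S = 0 ->
    exists2 F', fragmentation (enum T) F' & count triangle F' < count triangle F.
  move=> permS fragS triS; exists (S ++ rem D (rem s F)).
    apply: fragmentation_replace fragF permFsD _ fragS.
    by rewrite /= cats0 -(permPr permS) perm_cat2r.
  rewrite (permP permFsD) count_cat [leqRHS]count_cat triS ltn_add2r.
  by rewrite /= tri_s.
(* When [D] is an edge, this keeps the new triple starting at [x] from being a triangle. *)
have deg w w' : uniq [:: x; y; z; w; w'] -> e x w -> e x w' = false.
  rewrite cons_uniq -[[:: y; z; w; w']]/(rcons [:: y; z; w] w') rcons_uniq.
  move=> /and3P[_ w'N uniq_yzw] exw; rewrite (cubic_nbrs _ uniq_yzw) //=; first exact: negPf.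
  by rewrite exy exz exw.
have := allF D DF; move: x'D Ds permFsD uniq_sD swap DF.
case: D => [|a [|b [|c [|d D]]]] //.
  rewrite !inE => /orP[]/eqP ? _ _ uniq_sD swap _ /= eab; subst x'.
    right; apply: (swap [:: [:: y; z]; [:: x; a; b]]) => //=.
    - by perm_lia.
    - by rewrite eyz exx' eab.
    by rewrite (deg a b) //.
  right; apply: (swap [:: [:: y; z]; [:: x; b; a]]) => //=.
  - by perm_lia.
  - by rewrite eyz exx' e_sym eab.
  rewrite (deg b a) // (perm_uniq (_ : perm_eq _ [:: x; y; z; a; b])) //.
  by perm_lia.
rewrite !inE => /or3P[]/eqP ? _ _ uniq_sD swap DF /= /andP[eab ebc]; subst x'.
- right; apply: (swap [:: [:: y; z]; [:: x; a]; [:: b; c]]) => //=.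
    by perm_lia.
  by rewrite eyz exx' ebc.
(* If [D] is itself a triangle, [a c] is an edge and frees its middle vertex [b] for [x]. *)
- have [eac|neac] := boolP (e a c); last by left; exists a, b, c.
  right; apply: (swap [:: [:: y; z]; [:: x; b]; [:: a; c]]) => //=.
    by perm_lia.
  by rewrite eyz exx' eac.
right; apply: (swap [:: [:: y; z]; [:: x; c]; [:: a; b]]) => //=.
  by perm_lia.
by rewrite eyz exx' eab.
Qed.

(** Read as a boolean it counts the induced triples; under [pmap] it lists their midpoints. *)
Definition midpoint (s : seq T) : option T :=
  if s is [:: a; b; c] then if e a c then None else Some b else None.

(* The midpoint of an induced path on three vertices has only one neighbour
   left, so it can serve at most one triangle vertex. *)
Lemma few_triangles_or_fewer (F : seq (seq T)) : fragmentation (enum T) F ->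
  3 * count triangle F <= count midpoint F \/
  exists2 F', fragmentation (enum T) F' & count triangle F' < count triangle F.
Proof.
move=> fragF; have /andP[permF /allP allF] := fragF.
have uniq_F : uniq (flatten F) by rewrite (perm_uniq permF) enum_uniq.
pose TL := flatten [seq s <- F | triangle s]; pose CL := pmap midpoint F.
have [nbr|/allPn[x xTL noc]] := boolP (all (fun x => has (e x) CL) TL); last first.
  have /flattenP[s] := xTL; rewrite mem_filter => /andP[tri_s sF] xs.
  have [[a [b [c [abcF neac exb]]]]|] := triangle_nbr_or_fewer fragF sF tri_s xs.
    case/negP: noc; apply/hasP; exists b => //.
    by rewrite mem_pmap; apply/mapP; exists [:: a; b; c]; rewrite //= (negPf neac).
  by right.
left; have <- : size TL = 3 * count triangle F.
  rewrite /TL; elim: (F) allF => //= s K IHK allK.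
  have fs : fragment s by apply: allK; rewrite mem_head.
  have {}IHK : size (flatten [seq s <- K | triangle s]) = 3 * count triangle K.
    by apply: IHK => t tK; apply: allK; rewrite inE tK orbT.
  case: ifP => tri_s; rewrite ?add0n //= size_cat IHK mulnDr muln1.
  by case: s tri_s {fs allK} => [|? [|? [|? [|? ?]]]].
rewrite -size_pmap -/CL.
have uniq_TL : uniq TL.
  move: uniq_F; rewrite -(perm_uniq (perm_flatten (permEl (perm_filterC triangle F)))).
  by rewrite flatten_cat cat_uniq => /andP[].
rewrite -(card_uniqP uniq_TL) -cardsE.
(* The first listed midpoint adjacent to [x]; the default is never reached for [x] in [TL]. *)
pose f x := nth x CL (find (e x) CL).
have fP x : x \in TL -> f x \in CL /\ e x (f x).
  move/(allP nbr) => hasx; rewrite /f; split; last exact: nth_find.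
  by rewrite mem_nth // -has_find.
rewrite -(card_in_imset (f := f)).
  apply: leq_trans (card_size _); apply: subset_leq_card.
  by apply/subsetP => _ /imsetP[x xTL ->]; rewrite inE in xTL; case: (fP x xTL).
(* Two triangle vertices sharing the midpoint [b] of [a b c] would give [b] the four neighbours [a],
   [c], [x1], [x2]. *)
move=> x1 x2; rewrite !inE => x1T x2T f12; apply/eqP/negPn/negP => x12.
have [bC ex1] := fP _ x1T; have [_] := fP _ x2T; rewrite -f12.
move: bC; rewrite mem_pmap => /mapP[[|a [|b [|c [|? ?]]]] // abcF] /=.
case: ifP => // eac [E]; rewrite E in ex1 * => ex2.
have /andP[eab ebc] : e a b && e b c by apply: allF abcF.
have := flatten_uniq_mem uniq_F abcF; rewrite /= !inE negb_or -andbA => /and4P[ab ac bc _].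
have notin x : x \in TL -> x != a /\ x != c.
  move=> /flattenP[s]; rewrite mem_filter => /andP[tri_s sF] xs.
  by split; apply: contraTneq tri_s => xE;
     rewrite (flatten_uniq_disj uniq_F sF abcF xs) ?xE ?inE ?eqxx ?orbT //= eac.
have [x1a x1c] := notin _ x1T; have [x2a x2c] := notin _ x2T.
have := @cubic_nbrs b [:: a; c; x1] x2; rewrite [e b x2]e_sym ex2 /= !inE.
rewrite (eq_sym a x1) (eq_sym c x1) (negPf x1a) (negPf x1c) (negPf ac) (negPf x2a) (negPf x2c).
by rewrite ebc !(e_sym b) eab ex1 eq_sym (negPf x12) => /(_ erefl erefl erefl).
Qed.

(** Triangles are cut into an edge and a vertex. The balance holds block by block: [2 = 2] for an
    edge, [2 + 1 = 3] for an induced triple, [4 = 3 + 1] for a triangle. *)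
Lemma fragmentation_cover (F : seq (seq T)) (s : seq T) :
    fragmentation s F ->
  exists2 L, perm_eq (flatten L) s && all (fun s => (s != [::]) && chordless e s) L
    & 2 * size L + count midpoint F = size s + count triangle F.
Proof.
move=> /andP[permF allF].
pose cut s := if s is [:: x; y; z] then
  if e x z then [:: [:: x; y]; [:: z]] else [:: s] else [:: s].
exists (flatten [seq cut s | s <- F]).
  apply/andP; split.
    apply: perm_trans permF; rewrite (_ : flatten _ = flatten F) //.
    elim: (F) => //= t K IHK; rewrite flatten_cat IHK.
    by case: t => [|a [|b [|c [|? ?]]]] //=; rewrite ?cats0 //; case: ifP.
  apply/allP => t /flatten_mapP[u /(allP allF)].
  case: u => [|a [|b [|c [|? ?]]]] //=; rewrite ?inE.
    by move=> eab /eqP->; rewrite /= eab.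
  case: ifP => eac /andP[eab ebc]; rewrite !inE; last first.
    by move/eqP->; rewrite /= eab ebc eac.
  by move/orP=> []/eqP->; rewrite /= ?eab.
rewrite -(perm_size permF); elim: F allF {permF} => //= t K IHK /andP[ft /IHK].
rewrite !size_cat /= => {}IHK.
case: t ft => [|a [|b [|c [|? ?]]]] //=; first lia.
by case: ifP => /=; lia.
Qed.

End Fragmentations.

Ltac intro_conj :=
  repeat match goal with
  | |- is_true (_ && _) -> _ => move/andP=> []
  | |- is_true true -> _ => move=> _
  | |- is_true _ -> _ => let H := fresh "H" in move=> H
  end.

(** [intro_distinct] unpacks a [uniq] fact about an explicit sequence into disequalities; [distinct]
    then decides equality tests with them, in either orientation. *)
Ltac intro_distinct := rewrite /= ?in_cons ?in_nil ?orbF ?negb_or; intro_conj.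

Ltac distinct :=
  rewrite /= ?in_cons ?in_nil ?orbF ?negb_or;
  repeat match goal with
  | H : is_true (?x != ?y) |- context [?x == ?y] => rewrite (negPf H)
  | H : is_true (?x != ?y) |- context [?y == ?x] => rewrite (eq_sym y x) (negPf H)
  end;
  rewrite ?eqxx ?orbT ?orbF ?andbT //=.

(** * Perfect matchings in cubic graphs whose path covers all have at least n/2 paths *)

Section Matching.
Variables (T : finType) (e : rel T) (m : T -> T).
Hypotheses (e_sym : symmetric e) (e_irr : irreflexive e) (e_cubic : cubic e).
Hypotheses (mK : involutive m) (em : forall x, e x (m x)).

Let em' x : e (m x) x. Proof. by rewrite e_sym em. Qed.

Let paths L := all (fun s => (s != [::]) && chordless e s) L.

Lemma matching_neq (x : T) : m x != x.
Proof. by apply: contraTneq (em x) => ->; rewrite e_irr. Qed.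

Lemma matching_closed_cover (A : {set T}) : {homo m : x / x \in A} ->
  exists L, [/\ perm_eq (flatten L) (enum A), paths L & 2 * size L = #|A|].
Proof.
have [n] := ubnP #|A|; elim: n A => // n IHn A; rewrite ltnS => leAn clA.
have [->|[x xA]] := set_0Vmem A; first by exists [::]; rewrite enum_set0 cards0.
have cardA : #|A| = #|A :\: [set x; m x]| + 2.
  rewrite -(cardsID [set x; m x]) addnC (setIidPr _).
    by rewrite cards2 eq_sym matching_neq.
  by apply/subsetP => y; rewrite !inE => /orP[]/eqP-> //; apply: clA.
have [||L [permL allL sizeL]] := IHn (A :\: [set x; m x]).
- by move: leAn; rewrite cardA addn2 => /ltnW.
- move=> y; rewrite !inE !negb_or (can2_eq mK mK y x) (inj_eq (can_inj mK)).
  by move=> /andP[/andP[-> ->] /clA->].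
exists ([:: x; m x] :: L); split; last by rewrite /= mulnS addnC sizeL.
- apply: perm_trans (_ : perm_eq _ [:: x, m x & enum (A :\: [set x; m x])]) _.
    by rewrite /= !perm_cons.
  apply: uniq_perm; rewrite ?enum_uniq //.
    by rewrite /= !inE !mem_enum !inE !eqxx orbT enum_uniq eq_sym negb_or matching_neq.
  move=> y; rewrite !(inE, mem_enum); have [->|] := eqVneq y x; first by rewrite xA.
  by have [->|] := eqVneq y (m x); rewrite // clA.
by rewrite /paths /= em.
Qed.

(** The vertices outside [L] are again closed under [m], so matching edges cover them, two vertices
    per path. *)
Lemma matching_extend (L : seq (seq T)) :
    uniq (flatten L) -> {homo m : x / x \in flatten L} -> paths L ->
  exists2 L', path_cover e L' & 2 * size L' + size (flatten L) = #|T| + 2 * size L.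
Proof.
move=> uniqL clL allL.
have [|K [permK allK sizeK]] := @matching_closed_cover (~: [set x in flatten L]).
  move=> x; rewrite !inE; apply: contraNN => /clL; by rewrite mK.
exists (L ++ K).
  apply/andP; split; last by rewrite all_cat [X in X && _]allL.
  rewrite flatten_cat.
  apply: perm_trans (_ : perm_eq _ (flatten L ++ enum (~: [set x in flatten L]))) _.
    by rewrite perm_cat2l.
  apply: uniq_perm; rewrite ?enum_uniq //.
    rewrite cat_uniq uniqL enum_uniq andbT /=; apply/hasPn => x.
    by rewrite mem_enum !inE.
  by move=> x; rewrite mem_cat !mem_enum !inE orbN.
rewrite size_cat mulnDr sizeK; have := cardsC [set x in flatten L].
by rewrite cardsE (card_uniqP uniqL); lia.
Qed.

Hypothesis optimal : forall L, path_cover e L -> #|T| <= 2 * size L.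

(** Local form of optimality, and the source of the contradictions below: no two matching edges fit
    into one induced path, and no three into two. *)
Lemma matching_optimal (L : seq (seq T)) :
    uniq (flatten L) -> all (fun x => m x \in flatten L) (flatten L) -> paths L ->
  size (flatten L) <= 2 * size L.
Proof.
move=> uniqL /allP clL allL.
by have [K /optimal] := matching_extend uniqL clL allL; lia.
Qed.

Lemma matching_uniq4 (x y : T) : y != x -> y != m x -> uniq [:: x; m x; y; m y].
Proof.
move=> yx ymx; rewrite /= !inE !negb_or.
rewrite (eq_sym x y) (eq_sym (m x) y) (eq_sym x (m y)) (eq_sym x (m x)) (eq_sym y (m y)).
by rewrite (can2_eq mK mK y x) (inj_eq (can_inj mK)) !matching_neq (eq_sym x y) yx ymx.
Qed.

Lemma matching_uniq6 (x y z : T) : y != x -> y != m x ->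
  z != x -> z != m x -> z != y -> z != m y -> uniq [:: x; m x; y; m y; z; m z].
Proof.
move=> yx ymx zx zmx zy zmy.
move: (matching_uniq4 yx ymx) (matching_uniq4 zx zmx) (matching_uniq4 zy zmy).
do 3![intro_distinct]; distinct.
Qed.

(** Otherwise [m x, x, y, m y] is an induced path replacing two matching edges. *)
Lemma no_merge (x y : T) : y != x -> y != m x -> e x y ->
  [|| e (m x) y, e (m x) (m y) | e x (m y)].
Proof.
move=> yx ymx exy; apply/negPn/negP; rewrite !negb_or => /and3P[n1 n2 n3].
have := @matching_optimal [:: [:: m x; x; y; m y]].
have U : uniq [:: m x; x; y; m y].
  by move: (matching_uniq4 yx ymx); intro_distinct; distinct.
rewrite [flatten _]/= U /paths /= !inE !mK !eqxx !orbT.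
rewrite n1 n2 n3 exy (e_sym (m x)) ?em ?em'.
by move=> /(_ erefl erefl erefl).
Qed.

Ltac adj :=
  repeat match goal with
  | H : is_true (e ?x ?y) |- context [e ?x ?y] => rewrite H
  | H : is_true (e ?x ?y) |- context [e ?y ?x] => rewrite (e_sym y x) H
  | H : is_true (~~ e ?x ?y) |- context [e ?x ?y] => rewrite (negPf H)
  | H : is_true (~~ e ?x ?y) |- context [e ?y ?x] => rewrite (e_sym y x) (negPf H)
  | H : e ?x ?y = false |- context [e ?x ?y] => rewrite H
  end; rewrite ?em ?em' //=.

(** If not, [m u] has a third neighbour [d] outside both matching edges. The neighbourhoods of [u]
    and [m u] are then complete, and the edges of [u] and [d] can be merged. *)
Lemma shared_triangle (u a : T) : a != m u -> e u a -> e u (m a) ->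
  e (m u) a -> e (m u) (m a).
Proof.
move=> amu eua euma emua; apply/negPn/negP => nemuma.
have au : a != u by apply: contraTneq eua => ->; rewrite e_irr.
have := matching_uniq4 au amu; intro_distinct.
have [d emud] := cubic_nbr e_cubic (m u) (isT : size [:: u; a] < 3).
rewrite !inE negb_or => /andP[du da].
have dma : d != m a by apply: contraNneq nemuma => <-.
have dmu : d != m u by apply: contraTneq emud => ->; rewrite e_irr.
have := matching_uniq6 au amu du dmu da dma; intro_distinct.
have Nu w : e u w = (w \in [:: m u; a; m a]).
  by apply: cubic_nbrs => //; distinct; adj.
have Nmu w : e (m u) w = (w \in [:: u; a; d]).
  by apply: cubic_nbrs => //; distinct; adj.
have := no_merge (x := m u) (y := d); rewrite mK dmu du emud !Nu Nmu.
by move=> /(_ erefl erefl erefl); distinct.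
Qed.

(** By [shared_triangle], applied to [a] or [m a], it remains to exclude that [m u] is adjacent to
    neither. The third neighbour [g] of [a] then gives three matching edges that fit into two
    induced paths. *)
Lemma triangle_K4 (u a : T) : a != m u -> e u a -> e u (m a) ->
  e (m u) a && e (m u) (m a).
Proof.
move=> amu eua euma.
have au : a != u by apply: contraTneq eua => ->; rewrite e_irr.
have mamu : m a != m u by rewrite (inj_eq (can_inj mK)).
have mau : m a != u by rewrite (can2_eq mK mK).
have [emua|nemua] := boolP (e (m u) a); first by rewrite (shared_triangle amu).
have [emuma|nemuma] := boolP (e (m u) (m a)).
  by move: (shared_triangle mamu euma); rewrite mK => /(_ eua emuma); rewrite (negPf nemua).
have [d emud] := cubic_nbr e_cubic (m u) (isT : size [:: u] < 3); rewrite !inE => du.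
have dmu : d != m u by apply: contraTneq emud => ->; rewrite e_irr.
have da : d != a by apply: contraNneq nemua => <-.
have dma : d != m a by apply: contraNneq nemuma => <-.
have := matching_uniq6 au amu du dmu da dma; intro_distinct.
have Nu w : e u w = (w \in [:: m u; a; m a]).
  by apply: cubic_nbrs => //; distinct; adj.
have emumd : e (m u) (m d).
  have := no_merge (x := m u) (y := d); rewrite mK dmu du emud !Nu.
  by move=> /(_ erefl erefl erefl); distinct.
have Nmu w : e (m u) w = (w \in [:: u; d; m d]).
  by apply: cubic_nbrs => //; distinct; adj.
have [g eag] := cubic_nbr e_cubic a (isT : size [:: m a; u] < 3).
rewrite !inE negb_or => /andP[gma gu].
have ga : g != a by apply: contraTneq eag => ->; rewrite e_irr.
have gmu : g != m u by apply: contraNneq nemua => <-; rewrite e_sym.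
have := matching_uniq6 au amu gu gmu ga gma; intro_distinct.
have Na w : e a w = (w \in [:: m a; u; g]).
  by apply: cubic_nbrs => //; distinct; adj.
have mergeag := no_merge ga gma eag.
(* Since [a] is not adjacent to [m g], [no_merge] leaves only [m g] or [g] as the third neighbour of
   [m a]. *)
have [emamg|nemamg] := boolP (e (m a) (m g)).
  have Nma w : e (m a) w = (w \in [:: a; u; m g]).
    by apply: cubic_nbrs => //; distinct; adj.
  have := @matching_optimal [:: [:: m u; u; a]; [:: m a; m g; g]].
  rewrite /paths /= !mK; adj; rewrite Nma.
  by distinct => /(_ erefl erefl erefl).
have emag : e (m a) g.
  by move: mergeag; rewrite Na (negPf nemamg); distinct.
have Ng w : e g w = (w \in [:: m g; a; m a]).
  by apply: cubic_nbrs => //; distinct; adj.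
have emug : e (m u) g = false by rewrite e_sym Ng; distinct.
(* The neighbours of [m u] other than [u] are [d] and [m d], so it is adjacent to [m g] only if it
   is adjacent to [g]. *)
have emumg : e (m u) (m g) = false.
  move: emug; rewrite !Nmu !inE (can2_eq mK mK g u) (inj_eq (can_inj mK)).
  rewrite (can2_eq mK mK g d) -[X in X = false -> _]/(_ || _); distinct.
  by rewrite orbC.
have := @matching_optimal [:: [:: m u; u; a; g; m g]; [:: m a]].
rewrite /paths /= !mK; adj; rewrite !Nu Na.
by distinct => /(_ erefl erefl erefl).
Qed.

(** Otherwise the matching edges of [u], [a], [c] are forced to form a triangular prism, whose six
    vertices split into two induced paths. *)
Lemma nbrs_matched (u a c : T) : a != m u -> c != m u -> c != a ->
  e u a -> e u c -> c = m a.
Proof.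
move=> amu cmu ca eua euc; apply/eqP/negPn/negP => cma.
have au : a != u by apply: contraTneq eua => ->; rewrite e_irr.
have cu : c != u by apply: contraTneq euc => ->; rewrite e_irr.
have := matching_uniq6 au amu cu cmu ca cma; intro_distinct.
have Nu w : e u w = (w \in [:: m u; a; c]).
  by apply: cubic_nbrs => //; distinct; adj.
(* If [m u] were adjacent to [b] instead, [triangle_K4] at [b] would make [u] adjacent to [m b]. *)
have cross b : b \in [:: a; c] -> e (m u) (m b).
  move=> bac; have eub : e u b by rewrite Nu inE bac orbT.
  have neumb : e u (m b) = false.
    by move: bac; rewrite !inE Nu => /orP[]/eqP->; distinct.
  have bu : b != u by apply: contraTneq eub => ->; rewrite e_irr.
  have bmu : b != m u by move: bac; rewrite !inE => /orP[]/eqP->.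
  have := no_merge bu bmu eub; rewrite neumb orbF => /orP[emub|] //.
  have := @triangle_K4 b u; rewrite !(e_sym b) eub emub (e_sym (m b)) neumb.
  by rewrite -(can2_eq mK mK) eq_sym bmu => /(_ erefl erefl erefl).
have emuma : e (m u) (m a) by apply: cross; rewrite inE eqxx.
have emumc : e (m u) (m c) by apply: cross; rewrite !inE eqxx orbT.
have Nmu w : e (m u) w = (w \in [:: u; m a; m c]).
  by apply: cubic_nbrs => //; distinct; adj.
(* Without both edges, [a u c] and its image under [m] are two induced paths; [no_merge] then
   derives each edge from the other. *)
have eac_or : e a c || e (m a) (m c).
  apply/negPn/negP; rewrite negb_or => /andP[nac nmac].
  have := @matching_optimal [:: [:: a; u; c]; [:: m a; m u; m c]].
  by rewrite /paths /= !mK; adj; distinct => /(_ erefl erefl erefl).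
have [eac emamc] : e a c /\ e (m a) (m c).
  case/orP: eac_or => [eac|emamc]; split=> //.
    have Na w : e a w = (w \in [:: m a; u; c]).
      by apply: cubic_nbrs => //; distinct; adj.
    have Nc w : e c w = (w \in [:: m c; u; a]).
      by apply: cubic_nbrs => //; distinct; adj.
    by have := no_merge ca cma eac; rewrite (e_sym _ c) Nc Na; distinct.
  have Nma w : e (m a) w = (w \in [:: a; m u; m c]).
    by apply: cubic_nbrs => //; distinct; adj.
  have Nmc w : e (m c) w = (w \in [:: c; m u; m a]).
    by apply: cubic_nbrs => //; distinct; adj.
  have := no_merge (x := m a) (y := m c); rewrite mK (inj_eq (can_inj mK)) ca.
  rewrite (can2_eq mK mK) cma emamc (e_sym a) mK Nmc Nma.
  by move=> /(_ erefl erefl erefl); distinct.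
have Na w : e a w = (w \in [:: m a; u; c]).
  by apply: cubic_nbrs => //; distinct; adj.
have := @matching_optimal [:: [:: u; m u; m a]; [:: a; c; m c]].
rewrite /paths /= !mK; adj; rewrite Nu Na.
by distinct => /(_ erefl erefl erefl).
Qed.

Lemma matching_K4 (u : T) : exists a,
  uniq [:: u; m u; a; m a] /\
  {in [:: u; m u; a; m a], forall x y, e x y = (y != x) && (y \in [:: u; m u; a; m a])}.
Proof.
have [a eua] := cubic_nbr e_cubic u (isT : size [:: m u] < 3); rewrite inE => amu.
have au : a != u by apply: contraTneq eua => ->; rewrite e_irr.
have [c euc] := cubic_nbr e_cubic u (isT : size [:: m u; a] < 3).
rewrite !inE negb_or => /andP[cmu ca].
have euma : e u (m a) by rewrite -(nbrs_matched amu cmu ca eua euc).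
have /andP[emua emuma] := triangle_K4 amu eua euma.
have uniqK := matching_uniq4 au amu; exists a; split=> // x xK y.
move: uniqK; intro_distinct; move: xK; rewrite !inE => /or4P[]/eqP->.
- rewrite (@cubic_nbrs _ _ e_cubic u [:: m u; a; m a]); [|by distinct|by []|by rewrite /=; adj].
  by rewrite !inE; have [->|] := eqVneq y u; distinct.
- rewrite (@cubic_nbrs _ _ e_cubic (m u) [:: u; a; m a]); [|by distinct|by []|by rewrite /=; adj].
  by rewrite !inE; have [->|] := eqVneq y (m u); distinct.
- rewrite (@cubic_nbrs _ _ e_cubic a [:: u; m u; m a]); [|by distinct|by []|by rewrite /=; adj].
  by rewrite !inE; have [->|] := eqVneq y a; distinct.
rewrite (@cubic_nbrs _ _ e_cubic (m a) [:: u; m u; a]); [|by distinct|by []|by rewrite /=; adj].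
by rewrite !inE; have [->|] := eqVneq y (m a); distinct; rewrite orbF.
Qed.
End Matching.

(** * The dichotomy for cubic graphs, and the union of K4's *)

Section CubicCovers.
Variables (T : finType) (e : rel T).
Hypotheses (e_sym : symmetric e) (e_irr : irreflexive e).

Lemma pairs_matching (F : seq (seq T)) :
    fragmentation e (enum T) F -> all (fun s => size s == 2) F ->
  exists2 m : T -> T, involutive m & forall x, e x (m x).
Proof.
move=> /andP[permF /allP fragF] /allP pairF.
have uniqF : uniq (flatten F) by rewrite (perm_uniq permF) enum_uniq.
(* The partner of [x] in its block; the fallback [x] never occurs, as the pairs cover all
   vertices. *)
pose m x := if nth [::] F (find (fun s => x \in s) F) is [:: a; b] then
  (if x == a then b else a) else x.
have blockF x : exists a b, [/\ [:: a; b] \in F, x \in [:: a; b] & e a b].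
  have /flattenP[s sF xs] : x \in flatten F by rewrite (perm_mem permF) mem_enum.
  move: (fragF s sF) (pairF s sF).
  by case: s sF xs => [|a [|b [|]]] // abF xab eab _; exists a, b.
have mE a b : [:: a; b] \in F -> m a = b /\ m b = a.
  move=> abF; have := flatten_uniq_mem uniqF abF; rewrite /= inE andbT => ab.
  have block x : x \in [:: a; b] -> nth [::] F (find (fun s => x \in s) F) = [:: a; b].
    move=> xab; have hasx : has (fun s => x \in s) F by apply/hasP; exists [:: a; b].
    apply: (flatten_uniq_disj uniqF (x := x)) => //.
      by rewrite mem_nth // -has_find.
    exact: (nth_find [::] hasx).
  by rewrite /m !block ?inE ?eqxx ?orbT // eq_sym (negPf ab).
exists m => x; have [a [b [abF]]] := blockF x; have [ma mb] := mE a b abF.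
  by rewrite !inE => /orP[]/eqP-> _; rewrite ?ma ?mb ?ma.
by rewrite !inE => /orP[]/eqP-> eab; rewrite ?ma ?mb // e_sym.
Qed.

Hypothesis e_cubic : cubic e.

Lemma small_cover_or_pairs :
  (exists2 L, path_cover e L & 2 * size L < #|T|) \/
  exists2 F, fragmentation e (enum T) F & all (fun s => size s == 2) F.
Proof.
have [f f_inj ef] := regular_permutation e_sym (isT : 0 < 3) e_cubic.
have [F0 fragF0] := permutation_fragmentation e_irr f_inj ef.
have [n] := ubnP (count (triangle e) F0).
elim: n F0 fragF0 => // n IHn F fragF; rewrite ltnS => le_n.
have [few|[F' fragF' lt_n]] := few_triangles_or_fewer e_sym e_irr e_cubic fragF; last first.
  by apply: IHn fragF' _; apply: leq_trans lt_n le_n.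
have [L coverL sizeL] := fragmentation_cover fragF.
(* With t triangles and p induced triples, 3t <= p and 2|L| + p = n + t: either p > 0 and t < p,
   giving fewer than n/2 paths, or p = t = 0 and every block is an edge. *)
have [mid0|mid_gt0] := posnP (count (midpoint e) F); last first.
  left; exists L; rewrite // cardE -(ltn_add2r (count (midpoint e) F)) sizeL ltn_add2l.
  move: few mid_gt0; case: (count (triangle e) F) => // t few _.
  by apply: leq_trans few; lia.
right; exists F => //.
have tri0 : count (triangle e) F = 0.
  by move: few; rewrite mid0 leqn0 muln_eq0 => /eqP.
have /andP[_] := fragF; elim: (F) mid0 tri0 => //= s K IHK.
move=> /eqP; rewrite addn_eq0 => /andP[/eqP mid_s /eqP midK].
move=> /eqP; rewrite addn_eq0 => /andP[/eqP tri_s /eqP triK] /andP[frag_s fragK].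
rewrite IHK // andbT; case: s frag_s mid_s tri_s => [|a [|b [|c [|? ?]]]] //=.
by case: ifP.
Qed.

Lemma pairs_cover (F : seq (seq T)) :
    fragmentation e (enum T) F -> all (fun s => size s == 2) F ->
  path_cover e F /\ 2 * size F = #|T|.
Proof.
move=> /andP[permF /allP fragF] /allP pairF; split.
  rewrite /path_cover permF; apply/allP => s sF; move: (fragF s sF) (pairF s sF).
  by case: s {sF} => [|a [|b [|]]] //= ->.
rewrite cardE -(perm_size permF); elim: F pairF {permF fragF} => //= s F IHF pairF.
rewrite size_cat mulnS IHF => [|t tF]; last by rewrite pairF // inE tF orbT.
by rewrite (eqP (pairF s (mem_head _ _))).
Qed.

Lemma component_mem (x : T) : [set y | connect e x y] \in components e.
Proof. by apply/imsetP; exists x => //; apply/setP => y; rewrite !inE. Qed.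

Lemma K4_component (u v w x : T) :
    uniq [:: u; v; w; x] ->
    {in [:: u; v; w; x], forall y z, e y z = (z != y) && (z \in [:: u; v; w; x])} ->
  induced_iso e [set y | connect e u y] (complete_graph 4).
Proof.
set s := [:: u; v; w; x] => uniq_s adj_s.
exists (fun i : 'I_4 => nth u s i); split.
- by move=> i j /eqP; rewrite nth_uniq // => /eqP /val_inj.
- apply/setP => y; rewrite inE; apply/imsetP/idP => [[i _ ->]|].
    have [->|ne] := eqVneq (nth u s i) u; first exact: connect0.
    by apply: connect1; rewrite adj_s ?ne ?mem_nth // mem_head.
  move=> conn; suff ys : y \in s.
    have lt4 : index y s < 4 by rewrite index_mem.
    by exists (Ordinal lt4); rewrite //= nth_index.
  (* Neighbours of the four vertices stay among them, so the component is no larger. *)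
  have cl : closed e (mem s).
    apply: intro_closed; first exact: sym_connect_sym.
    by move=> a b eab /= ain; move: eab; rewrite adj_s // => /andP[].
  by have := closed_connect cl conn; rewrite !inE eqxx => /esym.
by move=> i j; rewrite adj_s ?mem_nth // andbT nth_uniq // eq_sym.
Qed.

(** The first and third vertices of a longer path lie in one component, a K4, so they are adjacent
    although not consecutive. *)
Lemma K4_induced_path (A : {set T}) :
    (forall C, C \in components e -> induced_iso e C (complete_graph 4)) ->
  induced_path_on e A -> #|A| <= 2.
Proof.
move=> K4 /existsP[s /andP[/andP[/and3P[_ uniq_s sorted_s] /'forall_implyP ind] _]].
rewrite -(size_tuple s); case: s uniq_s sorted_s ind => s _ /=.
case: s => [|x [|y [|z s]]] //; rewrite !cons_uniq !inE !negb_or.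
move=> /and3P[/and3P[xy xz xs] /andP[yz _] _] /and3P[exy eyz _].
move=> /(_ x); rewrite mem_head => /(_ isT)/'forall_implyP/(_ z).
rewrite !inE eqxx !orbT => /(_ isT)/eqP.
have -> : path_adj [:: x, y, z & s] x z = false.
  rewrite path_adjE infix2_head ?inE ?negb_or ?xy ?xz //.
  rewrite infix2_tail ?inE ?negb_or ?xy ?xz ?eqxx ?orbT // orbF.
  by rewrite (inj_eq Some_inj) (negPf yz).
pose C := [set w | connect e x w].
have /K4[f [_ /setP fC adjf]] := component_mem x.
have memC w : connect e x w -> exists i, w = f i.
  by move=> xw; have := fC w; rewrite inE xw => /imsetP[i _ ->]; exists i.
have [i xi] := memC x (connect0 _ _).
have [k zk] := memC z (connect_trans (connect1 exy) (connect1 eyz)).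
rewrite xi zk adjf /= => /esym/negbFE/eqP ik.
by move: xz; rewrite xi zk ik eqxx.
Qed.

Lemma K4_components_ipf (P : {set {set T}}) :
    (forall C, C \in components e -> induced_iso e C (complete_graph 4)) ->
  is_ipf e P -> #|T| <= 2 * #|P|.
Proof.
move=> K4 /andP[/card_partition cardP /'forall_implyP indP].
rewrite -cardsT cardP mulnC -sum_nat_const; apply: leq_sum => A /indP.
exact: K4_induced_path.
Qed.

End CubicCovers.

Theorem corollary2 (T : finType) (e : rel T)
    (e_sym : symmetric e) (e_irr : irreflexive e) (e_cubic : cubic e) :
  (exists P : {set {set T}}, is_ipf e P /\ 2 * #|P| <= #|T|) /\
  (2 * induced_path_number e = #|T| <->
   forall C : {set T}, C \in components e ->
     induced_iso e C (complete_graph 4)).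
Proof.
have [[Q ipfQ <-] minQ] := induced_path_numberP e_irr.
have cover_le L : path_cover e L -> #|Q| <= size L.
  by move=> /(path_cover_ipf e_sym e_irr)[P /minQ leP] /(leq_trans leP).
have leQ : 2 * #|Q| <= #|T|.
  case: (small_cover_or_pairs e_sym e_irr e_cubic).
    by move=> [L /cover_le leL ltL]; lia.
  by move=> [F fragF /(pairs_cover fragF)[/cover_le leF <-]]; rewrite leq_mul2l.
split; first by exists Q.
split=> [eqQ|K4]; last by apply/eqP; rewrite eqn_leq leQ (K4_components_ipf K4).
(* Equality rules out a cover with fewer than n/2 paths, so the dichotomy leaves a perfect
   matching. *)
have optimal L : path_cover e L -> #|T| <= 2 * size L by move/cover_le; lia.
have [F fragF pairF] : exists2 F, fragmentation e (enum T) F & all (fun s => size s == 2) F.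
  by case: (small_cover_or_pairs e_sym e_irr e_cubic) => // -[L /optimal]; lia.
have [m mK em] := pairs_matching e_sym fragF pairF.
move=> C /imsetP[u _ ->].
have [a [uniqK adjK]] := matching_K4 e_sym e_irr e_cubic mK em optimal u.
rewrite (_ : [set y in _ | _] = [set y | connect e u y]).
  exact: K4_component uniqK adjK.
by apply/setP => y; rewrite !inE.
Qed.
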